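(* Let $G$ be an infinite finitely generated group and $H\leq G$ a subgroup of finite index, $[G:H]<\infty$. Then \begin{itemize} \item $\mathrm{SDP}(G)\equiv_p \mathrm{SDP}(H)$, \item $\mathrm{RDP}(G)\equiv_p \mathrm{RDP}(H)$. \end{itemize}
   Context: Let $G$ be a finitely generated group and $S$ a finite generating set of $G$. For a finite alphabet $A$, a nearest neighbor pattern (with respect to $S$) is a tuple $(a,b,s)$ with $a,b\in A$, $s\in S$; it appears in $x\in A^G$ if there is $g\in G$ with $x(g)=a$ and $x(gs)=b$. For a finite set $\mathcal F$ of nearest neighbor patterns, $X_{\mathcal F}\subseteq A^G$ is the set of configurations $x:G\to A$ in which no pattern of $\mathcal F$ appears. Seeded domino problem $\mathrm{SDP}(G,S)$: given a finite alphabet $A$, a finite set $\mathcal F$ of nearest neighbor forbidden patterns and a letter $a_0\in A$, determine whether there is $x\in X_{\mathcal F}$ with $x(1_G)=a_0$. Recurrent domino problem $\mathrm{RDP}(G,S)$: same input; determine whether there is $x\in X_{\mathcal F}$ such that $\{g\in G: x(g)=a_0\}$ is infinite. $\mathrm{SDP}(G)$ and $\mathrm{RDP}(G)$ denote $\mathrm{SDP}(G,S)$ and $\mathrm{RDP}(G,S)$ for an arbitrary finite generating set $S$ of $G$ (different choices give positively equivalent problems), and similarly for $H$, which is finitely generated since it has finite index in $G$. Decision problems are identified with the languages of (encodings of) their yes instances. For languages $L,L'$, $L\leq_p L'$ ($L$ positive-reduces to $L'$) means that for any input $w$ one can compute finitely many finite sets $F_1(w),\dots,F_n(w)$ such that $w\in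 L$ if and only if there is $i\in\{1,\dots,n\}$ with $F_i(w)\subseteq L'$. We write $L\equiv_p L'$ if $L\leq_p L'$ and $L'\leq_p L$. *)

(* Defs.v *)
From mathcomp Require Import all_boot.
From mathcomp Require Import boolp classical_sets cardinality.

Set Implicit Arguments.
Unset Strict Implicit.
Unset Printing Implicit Defensive.

Local Open Scope classical_set_scope.

(* Partial recursive functions of arity n. *)
Inductive recfun : nat -> Type :=
| Zero n : recfun n
| Succ : recfun 1
| Proj n (i : 'I_n) : recfun n
| Comp k n (f : recfun k) (g : 'I_k -> recfun n) : recfun n
| PrimRec n (f : recfun n) (g : recfun n.+2) : recfun n.+1
| Mu n (f : recfun n.+1) : recfun n.

(* [eval f v y] : f is defined at v, with value y. In the case of primitive
   recursion, s is the sequence of intermediate values h(0), ..., h(v_0) where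
   h(0) = f(v_1, ...) and h(i+1) = g(i, h(i), v_1, ...). *)
Fixpoint eval n (f : recfun n) : n.-tuple nat -> nat -> Prop :=
  match f in recfun n return n.-tuple nat -> nat -> Prop with
  | Zero _ => fun _ y => y = 0
  | Succ => fun v y => y = (thead v).+1
  | Proj _ i => fun v y => y = tnth v i
  | Comp k _ f g => fun v y =>
      exists2 w : k.-tuple nat,
        forall i, eval (g i) v (tnth w i) & eval f w y
  | PrimRec n f g => fun v y =>
      exists s : nat -> nat,
        [/\ eval f [tuple of behead v] (s 0),
            forall i, i < thead v ->
              eval g [tuple of i :: s i :: behead v] (s i.+1)
          & y = s (thead v)]
  | Mu _ f => fun v y =>
      eval f [tuple of y :: v] 0 /\
      forall i, i < y -> exists z, eval f [tuple of i :: v] z.+1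
  end.

(* Inputs and outputs are coded by [pickle], which for numbers, ordinals,
   sequences, pairs and tagged unions is the usual effective Goedel numbering;
   it is computable in both directions for every type used below. *)
Definition computable (X Y : countType) (f : X -> Y) : Prop :=
  exists r : recfun 1, forall x, eval r [tuple pickle x] (pickle (f x)).

Definition pos_reducible (X Y : countType) (L : set X) (L' : set Y) : Prop :=
  exists2 F : X -> seq (seq Y), computable F &
    forall w, L w <-> exists2 Fi, Fi \in F w & [set` Fi] `<=` L'.

Definition pos_equiv (X Y : countType) (L : set X) (L' : set Y) : Prop :=
  pos_reducible L L' /\ pos_reducible L' L.

Definition generates (G : groupType) (S : seq G) : Prop :=
  smallest [set K : set G | group_closed [in K]] [set` S] = [set: G].

Definition finite_index (G : groupType) (P : {pred G}) : Prop :=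
  finite_set (range (fun g : G => [set (g * h)%g | h in [set` P]])).

(* A pattern (a, b, i) over the alphabet {0, ..., n-1} stands for (a, b, s)
   with s the i-th of the m generators. *)
Definition pattern (n m : nat) : Type := ('I_n * 'I_n * 'I_m)%type.

Definition appears (G : groupType) (S : seq G) n (p : pattern n (size S))
    (x : G -> 'I_n) : Prop :=
  let: (a, b, i) := p in exists g : G, x g = a /\ x (g * S`_i)%g = b.

Definition subshift (G : groupType) (S : seq G) n
    (F : seq (pattern n (size S))) : set (G -> 'I_n) :=
  [set x | forall p, p \in F -> ~ appears p x].

(* An instance: the size n of the alphabet, the forbidden patterns and the
   letter a_0. *)
Definition instance (m : nat) : countType :=
  {n : nat & (seq ('I_n * 'I_n * 'I_m) * 'I_n)%type}.

Definition SDP (G : groupType) (S : seq G) : set (instance (size S)) :=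
  [set w | let: existT n (F, a0) := w in
     exists2 x : G -> 'I_n, subshift F x & x 1%g = a0].

Definition RDP (G : groupType) (S : seq G) : set (instance (size S)) :=
  [set w | let: existT n (F, a0) := w in
     exists2 x : G -> 'I_n, subshift F x & infinite_set [set g | x g = a0]].

Arguments SDP [G] S.
Arguments RDP [G] S.

(* Main.v *)
Require Import Defs.
From mathcomp Require Import all_boot.
From mathcomp Require Import boolp classical_sets cardinality.
From mathcomp Require Import zify.

(* Let K embed in G by phi with finitely many right cosets, and let e be a
   finite list of elements of G. A configuration x on G is encoded over K by
   y(k) = (x(phi(k) e_p))_p, over an alphabet of size n ^ size e. Whenever
   e_p = phi(t) e_q with t a generator of K, the p-th digit of y(k) must equal
   the q-th digit of y(kt); whenever e_p s = e_q, a forbidden pattern (a, b, s)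
   forbids the digits a and b at p and q. These conditions are nearest neighbor
   with respect to the generators of K, and they characterise the encodings as
   soon as e contains representatives of the cosets, their translates by the
   steps s, and enough intermediate elements to join them through generators
   of K. With K = H this reduces the problems of G to those of H.
   Conversely, a configuration on H extends independently along the left cosets
   of H, so the problem for H and T is the problem for G and the steps T, which
   do not generate G; with K = G the encoding replaces T by S. *)

Set Implicit Arguments.
Unset Strict Implicit.
Unset Printing Implicit Defensive.

Local Open Scope classical_set_scope.

(** * Closure properties of recursive functions *)

(** Lists replace tuples so that environments can be cut and extended without dependent types; only
    the values at lists of length n are constrained. *)
Definition recursive n (f : seq nat -> nat) : Prop :=
  exists r : recfun n, forall v : n.-tuple nat, eval r v (f v).

Lemma recursive_ext n f g : f =1 g -> recursive n f -> recursive n g.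
Proof. by move=> fg [r rP]; exists r => v; rewrite -fg. Qed.

Lemma recursive_nth n i : recursive n (nth 0 ^~ i).
Proof.
have [lt_in|le_ni] := ltnP i n.
  by exists (Proj (Ordinal lt_in)) => v /=; rewrite (tnth_nth 0).
by exists (Zero n) => v /=; rewrite nth_default // size_tuple.
Qed.

Lemma recursive_comp k n h (g : nat -> seq nat -> nat) :
  recursive k h -> (forall i, i < k -> recursive n (g i)) ->
  recursive n (fun v => h (mkseq (g ^~ v) k)).
Proof.
move=> [rh rhP] gP.
have /choice[rg rgP] (i : 'I_k) :
  exists r : recfun n, forall v : n.-tuple nat, eval r v (g i v).
  exact: gP.
exists (Comp rh rg) => v /=; exists [tuple of mkseq (g ^~ v) k]; last exact: rhP.
by move=> i; rewrite (tnth_nth 0) nth_mkseq.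
Qed.

Lemma recursive_drop d n f :
  recursive n f -> recursive (d + n) (fun v => f (drop d v)).
Proof.
move=> fP.
have [r rP] : recursive (d + n) (fun v => f (mkseq (fun i => nth 0 v (d + i)) n)).
  by apply: (recursive_comp fP (g := fun i v => nth 0 v (d + i))) => i _;
    exact: recursive_nth.
exists r => v; rewrite -[drop d v](mkseq_nth 0) size_drop size_tuple addKn.
by under eq_mkseq do rewrite nth_drop.
Qed.

Lemma recursive_succ n f : recursive n f -> recursive n (fun v => (f v).+1).
Proof.
move=> fP.
apply: (@recursive_comp 1 n (fun v => (nth 0 v 0).+1) (fun=> f)) => //.
by exists Succ => v /=; rewrite /thead (tnth_nth 0).
Qed.

Lemma recursive_const n c : recursive n (fun=> c).
Proof. by elim: c => [|c]; [exists (Zero n) | exact: recursive_succ]. Qed.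

(** Primitive recursion as a binder: the loop body finds the counter at position 0, the accumulator
    at position 1 and the outer environment after these two. *)
Lemma recursive_iteri n k f (g : seq nat -> nat -> nat -> nat) :
  recursive n k -> recursive n f ->
  recursive n.+2 (fun v => g (drop 2 v) (nth 0 v 0) (nth 0 v 1)) ->
  recursive n (fun v => iteri (k v) (g v) (f v)).
Proof.
move=> kP [rf rfP] [rg rgP].
(* [PrimRec] wants the number of rounds as a first variable; composition with [k] fills it in
   afterwards. *)
pose h (v : seq nat) := iteri (head 0 v) (g (behead v)) (f (behead v)).
have hP : recursive n.+1 h.
  exists (PrimRec rf rg); case/tupleP=> x v /=.
  exists (fun m => iteri m (g v) (f v)).
  have -> : [tuple of behead [tuple of x :: v]] = v by exact: val_inj.
  split=> // i _; have := rgP [tuple of i :: iteri i (g v) (f v) :: v]; rewrite /= drop0.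
  by congr (eval rg _ _); apply: val_inj.
pose a i (v : seq nat) := if i is j.+1 then nth 0 v j else k v.
have [r rP] : recursive n (fun v => h (mkseq (a ^~ v) n.+1)).
  by apply: recursive_comp hP _ => -[_|i _]; [exact: kP|exact: recursive_nth].
exists r => v; have := rP v; rewrite /h.
have -> // : mkseq (a ^~ v) n.+1 = k v :: v.
rewrite /mkseq /= (iotaDl 1 0) -map_comp; congr cons.
by rewrite -[RHS](mkseq_nth 0) size_tuple.
Qed.

(* [weakening n k h] : h discards leading variables, turning an environment of
   size n into one of size k, as happens under the binders of [iteri]. *)
Definition weakening n k (h : seq nat -> seq nat) : Prop :=
  exists2 d, n = d + k & h =1 drop d.

Lemma weakening_id n : weakening n n id.
Proof. by exists 0 => // v; rewrite drop0. Qed.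

Lemma weakening_drop n k h :
  weakening n k.+2 h -> weakening n k (fun v => drop 2 (h v)).
Proof.
by case=> d -> hE; exists d.+2 => [|v]; rewrite ?hE ?drop_drop ?addSnnS.
Qed.

Lemma recursive_weaken n k f h :
  weakening n k h -> recursive k f -> recursive n (fun v => f (h v)).
Proof.
move=> [d -> hE] /(recursive_drop d); apply: recursive_ext => v.
by rewrite hE.
Qed.

Create HintDb rec discriminated.
#[local] Hint Constants Opaque : rec.
#[local] Hint Resolve weakening_id weakening_drop : rec.
#[local] Hint Resolve recursive_nth recursive_const recursive_succ recursive_iteri : rec.
(* Inside a loop body an outer function is evaluated at [drop 2] of the environment; these two rules
   bring it back to the outer environment. *)
#[local] Hint Extern 1 (recursive _ (fun v => nth 0 (drop 2 _) ?i)) =>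
  simple eapply (@recursive_weaken _ _ (fun v => nth 0 v i)) : rec.
#[local] Hint Extern 1 (recursive _ (fun v => ?f (drop 2 _))) =>
  is_var f; simple eapply (@recursive_weaken _ _ f) : rec.

Lemma recursive_add n f g :
  recursive n f -> recursive n g -> recursive n (fun v => f v + g v).
Proof.
move=> fP gP; apply: (@recursive_ext _ (fun v => iteri (g v) (fun _ s => s.+1) (f v))).
  by move=> v; elim: (g v) => [|k IHk] /=; rewrite ?addn0 // IHk addnS.
by eauto 20 with rec.
Qed.
#[local] Hint Resolve recursive_add : rec.

Lemma recursive_mul n f g :
  recursive n f -> recursive n g -> recursive n (fun v => f v * g v).
Proof.
move=> fP gP; apply: (@recursive_ext _ (fun v => iteri (g v) (fun _ s => s + f v) 0)).
  by move=> v; elim: (g v) => [|k IHk] /=; rewrite ?muln0 // IHk mulnSr.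
by eauto 20 with rec.
Qed.
#[local] Hint Resolve recursive_mul : rec.

Lemma recursive_pred n f : recursive n f -> recursive n (fun v => (f v).-1).
Proof.
move=> fP; apply: (@recursive_ext _ (fun v => iteri (f v) (fun i _ => i) 0)).
  by move=> v; case: (f v).
by eauto 20 with rec.
Qed.
#[local] Hint Resolve recursive_pred : rec.

Lemma recursive_sub n f g :
  recursive n f -> recursive n g -> recursive n (fun v => f v - g v).
Proof.
move=> fP gP.
apply: (@recursive_ext _ (fun v => iteri (g v) (fun _ s => s.-1) (f v))).
  by move=> v; elim: (g v) => [|k IHk] /=; rewrite ?subn0 // IHk subnS.
by eauto 20 with rec.
Qed.
#[local] Hint Resolve recursive_sub : rec.

Lemma recursive_exp n f g :
  recursive n f -> recursive n g -> recursive n (fun v => f v ^ g v).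
Proof.
move=> fP gP.
apply: (@recursive_ext _ (fun v => iteri (g v) (fun _ s => s * f v) 1)).
  by move=> v; elim: (g v) => [|k IHk] //=; rewrite IHk expnSr.
by eauto 20 with rec.
Qed.
#[local] Hint Resolve recursive_exp : rec.

Lemma recursive_sum n k (F : seq nat -> nat -> nat) :
  recursive n k -> recursive n.+2 (fun v => F (drop 2 v) (nth 0 v 0)) ->
  recursive n (fun v => \sum_(0 <= i < k v) F v i).
Proof.
move=> kP FP.
apply: (@recursive_ext _ (fun v => iteri (k v) (fun i s => s + F v i) 0)).
  by move=> v; elim: (k v) => [|j IHj]; rewrite ?big_nil ?big_nat_recr //= IHj.
by eauto 20 with rec.
Qed.
#[local] Hint Resolve recursive_sum : rec.

Lemma recursive_leq n f g :
  recursive n f -> recursive n g -> recursive n (fun v => f v <= g v).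
Proof.
move=> fP gP; apply: (@recursive_ext _ (fun v => 1 - (f v - g v))).
  by move=> v; rewrite /leq; case: (f v - g v).
by eauto 20 with rec.
Qed.
#[local] Hint Resolve recursive_leq : rec.

Lemma recursive_negb n (p : seq nat -> bool) :
  recursive n p -> recursive n (fun v => ~~ p v).
Proof.
move=> pP; apply: (@recursive_ext _ (fun v => 1 - p v)); last by eauto 20 with rec.
by move=> v; case: (p v).
Qed.
#[local] Hint Resolve recursive_negb : rec.

Lemma recursive_andb n (p q : seq nat -> bool) :
  recursive n p -> recursive n q -> recursive n (fun v => p v && q v).
Proof.
move=> pP qP; apply: (@recursive_ext _ (fun v => p v * q v)); last by eauto 20 with rec.
by move=> v; rewrite mulnb.
Qed.
#[local] Hint Resolve recursive_andb : rec.

Lemma recursive_orb n (p q : seq nat -> bool) :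
  recursive n p -> recursive n q -> recursive n (fun v => p v || q v).
Proof.
move=> pP qP; apply: (@recursive_ext _ (fun v => ~~ (~~ p v && ~~ q v))).
  by move=> v; rewrite negb_and !negbK.
by eauto 20 with rec.
Qed.
#[local] Hint Resolve recursive_orb : rec.

Lemma recursive_eq n f g :
  recursive n f -> recursive n g -> recursive n (fun v => f v == g v).
Proof.
move=> fP gP; apply: (@recursive_ext _ (fun v => (f v <= g v) && (g v <= f v))).
  by move=> v; rewrite eqn_leq.
by eauto 20 with rec.
Qed.
#[local] Hint Resolve recursive_eq : rec.

Lemma recursive_if n (p : seq nat -> bool) f g :
  recursive n p -> recursive n f -> recursive n g ->
  recursive n (fun v => if p v then f v else g v).
Proof.
move=> pP fP gP; apply: (@recursive_ext _ (fun v => p v * f v + ~~ p v * g v)).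
  by move=> v; case: (p v); rewrite !(mul0n, mul1n, addn0).
by eauto 20 with rec.
Qed.
#[local] Hint Resolve recursive_if : rec.

Lemma recursive_has_iota n k (p : seq nat -> nat -> bool) :
  recursive n k -> recursive n.+2 (fun v => p (drop 2 v) (nth 0 v 0)) ->
  recursive n (fun v => has (p v) (iota 0 (k v))).
Proof.
move=> kP pP; apply: (@recursive_ext _ (fun v => 0 < \sum_(0 <= i < k v) p v i)).
  move=> v; congr nat_of_bool; elim: (k v) => [|j IHj]; first by rewrite big_nil.
  rewrite -[X in iota 0 X]addn1 iotaD has_cat big_nat_recr //= addn_gt0 IHj orbF.
  by case: (p v j).
by eauto 20 with rec.
Qed.
#[local] Hint Resolve recursive_has_iota : rec.

Lemma recursive_has n (T : Type) (s : seq T) (p : seq nat -> T -> bool) :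
  (forall x, recursive n (fun v => p v x)) -> recursive n (fun v => has (p v) s).
Proof. by move=> pP; elim: s => [|x s IHs] /=; eauto 20 with rec. Qed.
#[local] Hint Resolve recursive_has : rec.

Lemma recursive_div n f g :
  recursive n f -> recursive n g -> recursive n (fun v => f v %/ g v).
Proof.
move=> fP gP.
(* The quotient counts the positive multiples of [g v] up to [f v]; the factor [0 < g v] gives
   division by zero its value 0. *)
apply: (@recursive_ext _ (fun v => (0 < g v) * \sum_(0 <= i < f v) (i.+1 * g v <= f v))).
  move=> v; case: (posnP (g v)) => [->|g_gt0]; first by rewrite divn0.
  rewrite mul1n; under eq_bigr do rewrite -leq_divRL //.
  have := leq_div (f v) (g v); move: (f v %/ g v) => q.
  elim: (f v) q => [|j IHj] q; first by rewrite leqn0 big_nil => /eqP.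
  rewrite big_nat_recr //=; case: (ltngtP q j.+1) => // [le_qj _|-> _].
    by rewrite IHj // addn0.
  rewrite addn1; congr succn; rewrite big_nat.
  under eq_bigr => i /andP[_ /ltnW] do rewrite ltnS => ->.
  by rewrite -big_nat sum_nat_const_nat subn0 muln1.
by eauto 20 with rec.
Qed.
#[local] Hint Resolve recursive_div : rec.

Lemma recursive_mod n f g :
  recursive n f -> recursive n g -> recursive n (fun v => f v %% g v).
Proof.
move=> fP gP; apply: (@recursive_ext _ (fun v => f v - f v %/ g v * g v)).
  by move=> v; rewrite {1}(divn_eq (f v) (g v)) addKn.
by eauto 20 with rec.
Qed.
#[local] Hint Resolve recursive_mod : rec.

Lemma recursive_logn2 n f : recursive n f -> recursive n (fun v => logn 2 (f v)).
Proof.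
move=> fP.
(* The valuation counts the positive exponents k < [f v] for which 2 ^ k divides [f v], with k = i +
   1. *)
apply: (@recursive_ext _ (fun v => \sum_(0 <= i < (f v).-1) (f v %% 2 ^ i.+1 == 0))).
  by move=> v; rewrite logn_count_dvd // big_add1.
by eauto 20 with rec.
Qed.
#[local] Hint Resolve recursive_logn2 : rec.

(** * Goedel numbers of sequences and the reduction *)

(** [CodeSeq.code] sends the empty list to 0 and x :: s to 2 ^ x * (2 c + 1), with c the code of s;
    the head is therefore the 2-adic valuation. *)
Definition code_head c := logn 2 c.
Definition code_tail c := c %/ 2 ^ (logn 2 c).+1.

Lemma code_cons_gt0 x s : 0 < CodeSeq.code (x :: s).
Proof. by rewrite /= muln_gt0 expn_gt0. Qed.

Lemma code_headK x s : code_head (CodeSeq.code (x :: s)) = x.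
Proof.
rewrite /code_head /= lognM ?expn_gt0 // pfactorK //.
by rewrite logn_coprime ?addn0 // coprime2n /= odd_double.
Qed.

Lemma code_tailK x s : code_tail (CodeSeq.code (x :: s)) = CodeSeq.code s.
Proof.
rewrite /code_tail -[logn _ _]/(code_head _) code_headK /= expnSr.
by rewrite divnMl ?expn_gt0 // divn2 /= uphalf_double.
Qed.

Definition code_drop j c := iteri j (fun=> code_tail) c.

Lemma code_dropE j s : code_drop j (CodeSeq.code s) = CodeSeq.code (drop j s).
Proof.
rewrite /code_drop; elim: j s => [|j IHj] s; rewrite ?drop0 //= IHj.
case: (ltnP j (size s)) => [lt_js|le_sj]; first by rewrite (drop_nth 0) // code_tailK.
by rewrite !drop_oversize // leqW.
Qed.

(** A code is at least the length of its list, so c bounds the search. The test against 0 detects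
    the end of the list, where [code_head] would return a spurious 0. *)
Definition code_mem v c :=
  has (fun j => (code_drop j c != 0) && (code_head (code_drop j c) == v)) (iota 0 c).

Lemma code_memE v s : code_mem v (CodeSeq.code s) = (v \in s).
Proof.
have le_code : size s <= CodeSeq.code s.
  elim: s => //= x s IHs; rewrite -[(size s).+1]mul1n leq_mul ?expn_gt0 //.
  by rewrite ltnS -addnn (leq_trans IHs) // leq_addr.
apply/hasP/idP => [[j _]|v_s].
  rewrite code_dropE; case: (ltnP j (size s)) => [lt_js|le_sj];
    last by rewrite drop_oversize.
  by rewrite (drop_nth 0) // code_headK => /andP[_ /eqP<-]; apply: mem_nth.
have lt_vs : index v s < size s by rewrite index_mem.
exists (index v s); first by rewrite mem_iota (leq_trans lt_vs).
rewrite code_dropE (drop_nth 0) // code_headK nth_index // eqxx andbT.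
by rewrite -lt0n code_cons_gt0.
Qed.

(** Each round puts its element in front of the earlier ones, so the coded list runs through the
    indices in decreasing order. *)
Definition code_filter k (p : pred nat) (g : nat -> nat) :=
  iteri k (fun i c => if p i then 2 ^ g i * (2 * c).+1 else c) 0.

Lemma code_filterE k p g :
  code_filter k p g = CodeSeq.code [seq g i | i <- rev (iota 0 k) & p i].
Proof.
rewrite /code_filter; elim: k => [|k IHk] //.
rewrite -[X in iota 0 X]addn1 iotaD rev_cat /= IHk.
by case: (p k); rewrite //= mul2n.
Qed.

Lemma recursive_code_head n f : recursive n f -> recursive n (fun v => code_head (f v)).
Proof. exact: recursive_logn2. Qed.

Lemma recursive_code_tail n f : recursive n f -> recursive n (fun v => code_tail (f v)).
Proof. by move=> fP; rewrite /code_tail; eauto 20 with rec. Qed.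
#[local] Hint Resolve recursive_code_head recursive_code_tail : rec.

Lemma recursive_code_drop n k f :
  recursive n k -> recursive n f -> recursive n (fun v => code_drop (k v) (f v)).
Proof. by move=> kP fP; rewrite /code_drop; eauto 20 with rec. Qed.
#[local] Hint Resolve recursive_code_drop : rec.

Lemma recursive_code_mem n f g :
  recursive n f -> recursive n g -> recursive n (fun v => code_mem (f v) (g v)).
Proof. by move=> fP gP; rewrite /code_mem; eauto 20 with rec. Qed.
#[local] Hint Resolve recursive_code_mem : rec.

Lemma recursive_code_filter n k (p : seq nat -> pred nat) g :
  recursive n k -> recursive n.+2 (fun v => p (drop 2 v) (nth 0 v 0)) ->
  recursive n.+2 (fun v => g (drop 2 v) (nth 0 v 0)) ->
  recursive n (fun v => code_filter (k v) (p v) (g v)).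
Proof. by move=> kP pP gP; rewrite /code_filter; eauto 20 with rec. Qed.
#[local] Hint Resolve recursive_code_filter : rec.

Lemma recursive_code2 n f g : recursive n f -> recursive n g ->
  recursive n (fun v => CodeSeq.code [:: f v; g v]).
Proof.
move=> fP gP; apply: (@recursive_ext _ (fun v => 2 ^ f v * (2 * 2 ^ g v).+1)).
  by move=> v; rewrite /= muln1 mul2n.
by eauto 20 with rec.
Qed.
#[local] Hint Resolve recursive_code2 : rec.

Section Reduction.

(** [C] will list the (t, p, q) with e_p = phi(t) e_q, [D] the (s, p, q) with e_p s = e_q, and [E]
    the positions where a_0 is sought. These finite lists depend on the groups and not on the
    instance, so they enter the algorithm as constants and no word problem has to be solved. *)
Variables (m m' r : nat) (m'_gt0 : 0 < m') (C D : seq (nat * nat * nat)) (E : seq nat).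

(* The letter a < n ^ r codes the r-tuple of its base n digits. *)
Definition digit n p a := a %/ n ^ p %% n.

Definition bad n F a b t :=
  has (fun c : nat * nat * nat => (c.1.1 == t) && (digit n c.1.2 a != digit n c.2 b)) C ||
  has (fun d : nat * nat * nat => code_mem (CodeSeq.code
    [:: CodeSeq.code [:: digit n d.1.2 a; digit n d.2 a]; d.1.1]) F) D.

(** Arithmetic counterpart of [reduction], with [F] a Goedel number. The triple (a, b, t) has index
    i = a + N (b + N t), and 2 ^ x codes the one-element list with entry x. *)
Definition reduction_code n F a0 :=
  let N := n ^ r in
  code_filter N (fun a => has (fun p => digit n p a == a0) E)
    (fun a => 2 ^ CodeSeq.code [:: N; CodeSeq.code [::
       code_filter (N * N * m')
         (fun i => bad n F (i %% N) (i %/ N %% N) (i %/ N %/ N %% m'))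
         (fun i => CodeSeq.code [:: CodeSeq.code [:: i %% N; i %/ N %% N];
            i %/ N %/ N %% m']);
       a %% N]]).

Lemma recursive_digit n f p g : recursive n f -> recursive n g ->
  recursive n (fun v => digit (f v) p (g v)).
Proof. by move=> fP gP; rewrite /digit; eauto 20 with rec. Qed.
#[local] Hint Resolve recursive_digit : rec.

Lemma recursive_bad n f g h i j :
  recursive n f -> recursive n g -> recursive n h -> recursive n i -> recursive n j ->
  recursive n (fun v => bad (f v) (g v) (h v) (i v) (j v)).
Proof. by move=> fP gP hP iP jP; rewrite /bad; eauto 60 with rec. Qed.
#[local] Hint Resolve recursive_bad : rec.

Lemma recursive_reduction_code n f g h :
  recursive n f -> recursive n g -> recursive n h ->
  recursive n (fun v => reduction_code (f v) (g v) (h v)).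
Proof. by move=> fP gP hP; rewrite /reduction_code; eauto 100 with rec. Qed.
#[local] Hint Resolve recursive_reduction_code : rec.

Definition ord_mod N (N_gt0 : 0 < N) i := Ordinal (ltn_pmod i N_gt0).

Lemma alphabet_gt0 n (a0 : 'I_n) : 0 < n ^ r.
Proof. by rewrite expn_gt0 (leq_trans _ (ltn_ord a0)). Qed.

Definition reduction_patterns n (F : seq ('I_n * 'I_n * 'I_m)) (a0 : 'I_n) :
    seq ('I_(n ^ r) * 'I_(n ^ r) * 'I_m') :=
  let N := n ^ r in let N_gt0 := alphabet_gt0 a0 in
  [seq (ord_mod N_gt0 i, ord_mod N_gt0 (i %/ N), ord_mod m'_gt0 (i %/ N %/ N))
    | i <- rev (iota 0 (N * N * m'))
    & bad n (pickle F) (i %% N) (i %/ N %% N) (i %/ N %/ N %% m')].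

(** The disjunction allowed by a positive reduction is spent on the choice of the new distinguished
    letter: one singleton for each letter that shows a_0 at a position of [E]. *)
Definition reduction (w : instance m) : seq (seq (instance m')) :=
  let: existT n (F, a0) := w in
  [seq [:: (existT _ (n ^ r) (reduction_patterns F a0, ord_mod (alphabet_gt0 a0) a)
            : instance m')]
    | a <- rev (iota 0 (n ^ r)) & has (fun p => digit n p a == a0) E].

Lemma computable_reduction : computable reduction.
Proof.
have [f fP] : recursive 1 (fun v => reduction_code (code_head (nth 0 v 0))
    (code_head (code_head (code_tail (nth 0 v 0))))
    (code_head (code_tail (code_head (code_tail (nth 0 v 0)))))).
  by eauto 60 with rec.
exists f => -[n [F a0]]; have := fP [tuple pickle (existT _ n (F, a0) : instance m)].
congr eval; set c := pickle _.
(* Pairs and tagged values are pickled as two-element lists, so this holds by conversion. *)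
have -> : nth 0 [tuple c] 0 =
    CodeSeq.code [:: n; CodeSeq.code [:: pickle F; val a0]] by [].
rewrite !(code_headK, code_tailK) /reduction_code.
rewrite code_filterE /reduction -[RHS]/(CodeSeq.code _) -map_comp.
congr CodeSeq.code; apply: eq_map => a.
rewrite code_filterE -[LHS]muln1 -[RHS]/(CodeSeq.code [:: CodeSeq.code [:: n ^ r;
  CodeSeq.code [:: CodeSeq.code (map pickle (reduction_patterns F a0)); a %% n ^ r]]]).
by rewrite /reduction_patterns -map_comp.
Qed.

End Reduction.

(** * Base n digits and the meaning of the reduced instance *)

Lemma code2_inj a b c d :
  CodeSeq.code [:: a; b] = CodeSeq.code [:: c; d] -> a = c /\ b = d.
Proof. by move=> /(congr1 CodeSeq.decode); rewrite !CodeSeq.codeK => -[]. Qed.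

Lemma digit_exists n r (f : nat -> 'I_n) :
  exists a : 'I_(n ^ r), forall p, p < r -> digit n p a = f p.
Proof.
have n_gt0 : 0 < n := leq_ltn_trans (leq0n _) (ltn_ord (f 0)).
have ltf p : f p < n := ltn_ord (f p).
elim: r => [|r [a aP]]; first by exists (Ordinal (ltnSn 0)).
have lt_b : a + f r * n ^ r < n ^ r.+1.
  rewrite expnS (leq_trans (_ : _ < (f r).+1 * n ^ r)) //.
    by rewrite mulSn ltn_add2r.
  by rewrite leq_mul2r ltf orbT.
exists (Ordinal lt_b) => p; rewrite ltnS leq_eqVlt /digit => /orP[/eqP->|lt_pr] /=.
  by rewrite divnDMl ?expn_gt0 ?n_gt0 // divn_small // add0n modn_small.
(* The new leading term is a multiple of n * n ^ p, so it leaves the digit at p < r unchanged. *)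
have -> : f r * n ^ r = f r * n ^ (r - p).-1 * n * n ^ p.
  by rewrite -!mulnA -expnS -expnD; congr (_ * n ^ _); lia.
rewrite divnDMl ?expn_gt0 ?n_gt0 // addnC modnMDl.
exact: aP.
Qed.

Section ReductionSemantics.

Variables (m m' r : nat) (m'_gt0 : 0 < m') (C D : seq (nat * nat * nat)) (E : seq nat).
Variables (n : nat) (F : seq ('I_n * 'I_n * 'I_m)) (a0 : 'I_n).

Lemma badP a b t : reflect
  ((exists p q, (t, p, q) \in C /\ digit n p a <> digit n q b) \/
   (exists2 P, P \in F & exists p q,
      [/\ (val P.2, p, q) \in D, digit n p a = P.1.1 & digit n q a = P.1.2]))
  (bad C D n (pickle F) a b t).
Proof.
apply: (iffP orP) => -[].
- case/hasP => -[[t' p] q] /= CP /andP[/eqP eq_t /eqP neq].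
  by left; exists p, q; rewrite -eq_t.
- case/hasP => -[[s p] q] /= DP; rewrite code_memE => /mapP[[[a1 b1] s1] P1 eqP1].
  right; exists (a1, b1, s1) => //; exists p, q.
  have {}eqP1 : CodeSeq.code [:: CodeSeq.code [:: digit n p a; digit n q a]; s] =
      CodeSeq.code [:: CodeSeq.code [:: val a1; val b1]; val s1] by exact: eqP1.
  by have [/code2_inj[-> ->] <-] := code2_inj eqP1.
- case=> p [q] [Ctpq /eqP neq]; left; apply/hasP; exists (t, p, q) => //=.
  by rewrite eqxx.
- case=> -[[a1 b1] s1] PF [p [q]] /= [Dspq eq_a eq_b].
  right; apply/hasP; exists (val s1, p, q) => //=; rewrite code_memE.
  by apply/mapP; exists (a1, b1, s1) => //; rewrite eq_a eq_b.
Qed.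

Lemma mem_reduction_patterns (a b : 'I_(n ^ r)) (t : 'I_m') :
  ((a, b, t) \in reduction_patterns r m'_gt0 C D F a0) = bad C D n (pickle F) a b t.
Proof.
apply/mapP/idP => [[i] + [-> -> ->]|bad_abt]; first by rewrite mem_filter => /andP[].
set N := n ^ r; have N_gt0 : 0 < N := alphabet_gt0 r a0.
(* The index under which the enumeration meets (a, b, t); [i1] to [i5] recover the three
   components. *)
pose i := a + (b + t * N) * N.
have i1 : i %% N = a by rewrite /i addnC modnMDl modn_small.
have i2 : i %/ N = b + t * N by rewrite /i divnDMl // divn_small.
have i3 : (b + t * N) %% N = b by rewrite addnC modnMDl modn_small.
have i4 : (b + t * N) %/ N = t by rewrite divnDMl // divn_small.
have i5 : t %% m' = t by rewrite modn_small.
exists i; last first.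
  by congr (_, _, _); apply: val_inj; rewrite /= ?i1 ?i2 ?i3 ?i4 ?i5.
rewrite mem_filter i1 i2 i3 i4 i5 bad_abt mem_rev mem_iota /=.
have := ltn_ord a; have := ltn_ord b; have := ltn_ord t; rewrite -/N /i. nia.
Qed.

Lemma mem_reduction (Fi : seq (instance m')) :
  Fi \in reduction r m'_gt0 C D E (existT _ n (F, a0)) <->
  exists a : 'I_(n ^ r), (exists2 p, p \in E & digit n p a = a0) /\
    Fi = [:: (existT _ (n ^ r) (reduction_patterns r m'_gt0 C D F a0, a) : instance m')].
Proof.
split=> [/mapP[a]|[a [[p pE pa] ->]]].
  rewrite mem_filter mem_rev mem_iota /= => /andP[/hasP[p pE /eqP pa] lt_a ->].
  exists (Ordinal lt_a); split; first by exists p.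
  suff -> : ord_mod (alphabet_gt0 r a0) a = Ordinal lt_a by [].
  by apply: val_inj; rewrite /= modn_small.
apply/mapP; exists (val a).
  rewrite mem_filter mem_rev mem_iota /= ltn_ord andbT.
  by apply/hasP; exists p => //; rewrite pa.
suff -> : ord_mod (alphabet_gt0 r a0) a = a by [].
by apply: val_inj; rewrite /= modn_small.
Qed.

End ReductionSemantics.

Definition triples m r :=
  [seq (tp, q) | tp <- [seq (t, p) | t <- iota 0 m, p <- iota 0 r], q <- iota 0 r].

Lemma mem_triples m r t p q : ((t, p, q) \in triples m r) = [&& t < m, p < r & q < r].
Proof.
apply/allpairsP/and3P => [[[tp q'] /= [/allpairsP[[t' p'] /= [+ + ->]] + [-> -> ->]]]|[]].
  by rewrite !mem_iota.
move=> tm pr qr; exists (t, p, q); rewrite /= mem_iota qr; split=> //.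
by apply: allpairs_f; rewrite mem_iota.
Qed.

(** * Transfer of configurations between groups *)

(** Pigeonhole principle, applied below to cosets and to letters. *)
Lemma infinite_fiber (T : Type) (I : eqType) (s : seq I) (f : T -> I) (A : set T) :
  (forall t, A t -> f t \in s) -> infinite_set A ->
  exists2 i, i \in s & infinite_set [set t | A t /\ f t = i].
Proof.
move=> fs; apply: contra_notP => /forall2NP finA.
apply: (@sub_finite_set _ _ (\bigcup_(i in [set` s]) [set t | A t /\ f t = i])).
  by move=> t At; exists (f t) => //; exact: fs.
apply: bigcup_finite => // i /= si.
by have [/(_ si)//|/contrapT] := finA i.
Qed.

Section StepSubshift.

Variables (G : groupType) (m : nat) (sigma : nat -> G).

(** The steps are not assumed to generate [G], so that the generators of a subgroup can serve as
    steps in the whole group. *)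
Definition step_subshift n (F : seq (pattern n m)) : set (G -> 'I_n) :=
  [set x | forall p, p \in F ->
    ~ exists g, x g = p.1.1 /\ x (g * sigma p.2)%g = p.1.2].

Definition step_SDP : set (instance m) :=
  [set w | let: existT n (F, a0) := w in
     exists2 x : G -> 'I_n, step_subshift F x & x 1%g = a0].

Definition step_RDP : set (instance m) :=
  [set w | let: existT n (F, a0) := w in
     exists2 x : G -> 'I_n, step_subshift F x & infinite_set [set g | x g = a0]].

End StepSubshift.

Section Encoding.

Variables (G K : groupType) (phi : K -> G) (tau : seq K).
Hypothesis phiM : {morph phi : k l / (k * l)%g}.
Hypothesis phi_inj : injective phi.
Hypothesis tau_gen : generates tau.
Hypothesis tau_gt0 : 0 < size tau.

(** Decomposition along the right cosets of phi(K): [rep] picks the representative of the coset and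
    [sec] the coordinate in [K]. *)
Variables (sec : G -> K) (rep : G -> G) (reps : seq G).
Hypothesis secP : forall g, g = (phi (sec g) * rep g)%g.
Hypothesis repM : forall k g, rep (phi k * g)%g = rep g.
Hypothesis rep_reps : forall g, rep g \in reps.
Hypothesis repK : {in reps, forall c, rep c = c}.

Local Open Scope group_scope.

Lemma phi1 : phi 1 = 1.
Proof. by apply: (mulgI (phi 1)); rewrite -phiM !mulg1. Qed.

Lemma secM k g : sec (phi k * g) = k * sec g.
Proof.
apply: phi_inj; apply: (mulIg (rep g)).
by rewrite phiM -mulgA -(secP g) -[in LHS](repM k g) -[LHS]secP.
Qed.

Lemma sec_reps c : c \in reps -> sec c = 1.
Proof.
move=> /repK c_rep; apply: phi_inj; apply: (mulIg c).
by rewrite phi1 mul1g [RHS]secP c_rep.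
Qed.

(* [e] grows from the representatives by left multiplication with generators
   and their inverses. *)
Inductive connected : seq G -> Prop :=
| connected_reps : connected reps
| connected_cons e g h i : connected e -> h \in e -> i < size tau ->
    g = phi tau`_i * h \/ h = phi tau`_i * g -> connected (g :: e).

Definition extendable g := forall e, connected e ->
  exists e', [/\ connected e', {subset e <= e'} & g \in e'].

(** The elements of [K] whose left translation, and that of their inverse, preserves extendability
    form a subgroup containing [tau], hence all of [K]. *)
Lemma extendable_phi k g : extendable g -> extendable (phi k * g).
Proof.
(* Both k and k^-1 are required so that M is visibly closed under inverses. *)
pose M : set K := [set k | forall g, extendable g ->
  extendable (phi k * g) /\ extendable (phi k^-1 * g)].
suff /(_ k I) /(_ g) Mk : [set: K] `<=` M by move=> /Mk[].
rewrite -tau_gen; apply: smallest_sub => [|t /= tau_t]; last first.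
  have ti : index t tau < size tau by rewrite index_mem.
  have tE : tau`_(index t tau) = t by rewrite nth_index.
  move=> h h_ext; split=> e e_conn; have [e' [e'_conn sub he']] := h_ext _ e_conn.
    exists (phi t * h :: e'); split; last exact: mem_head.
      by apply: connected_cons e'_conn he' ti _; left; rewrite tE.
    by move=> x /sub xe'; rewrite in_cons xe' orbT.
  exists (phi t^-1 * h :: e'); split; last exact: mem_head.
    apply: connected_cons e'_conn he' ti _; right.
    by rewrite tE mulgA -phiM mulgV phi1 mul1g.
  by move=> x /sub xe'; rewrite in_cons xe' orbT.
split=> [|a b]; rewrite !inE.
  by move=> h h_ext; rewrite invg1 phi1 mul1g.
move=> Ma Mb h h_ext; rewrite invgM invgK !phiM -!mulgA; split.
  by apply: (Ma _ _).1; exact: (Mb _ _).2.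
by apply: (Mb _ _).1; exact: (Ma _ _).2.
Qed.

(** Every connected list contains [rep g], and g is its translate by phi(sec g). *)
Lemma extendableT g : extendable g.
Proof.
rewrite (secP g); apply: extendable_phi => e e_conn; exists e; split=> //.
by elim: e_conn => [|e' ? ? ? _ IH _ _ _]; rewrite ?rep_reps // in_cons IH orbT.
Qed.

Lemma connected_sup (s : seq G) : exists2 e, connected e & {subset s <= e}.
Proof.
elim: s => [|g s [e e_conn sub]]; first by exists reps => //; exact: connected_reps.
have [e' [e'_conn sub' ge']] := extendableT g e_conn.
by exists e' => // x; rewrite in_cons => /orP[/eqP->//|/sub/sub'].
Qed.

(** * Encoding and decoding of configurations *)

Section Transfer.

Variables (m : nat) (sigma : nat -> G) (e : seq G).
Hypothesis e_conn : connected e.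
Hypothesis e_sigma : forall c s, c \in reps -> s < m -> c * sigma s \in e.

Let r := size e.
Let C := [seq c <- triples (size tau) r |
  e`_c.1.2 == phi tau`_c.1.1 * e`_c.2].
Let D := [seq d <- triples m r | e`_d.1.2 * sigma d.1.1 == e`_d.2].

Variables (n : nat) (F : seq (pattern n m)) (a0 : 'I_n).
Let F' := reduction_patterns r tau_gt0 C D F a0.

(** The letter y(k) records x on the window phi(k) e. Overlapping windows agree because they come
    from one x, and a violation of [D] at k would be a pattern of [F] appearing in x at phi(k)
    e_p. *)
Lemma step_subshift_encode x : step_subshift sigma F x ->
  exists2 y, subshift F' y &
    forall k p, p < r -> digit n p (y k) = x (phi k * e`_p).
Proof.
move=> xF; have /choice[y yP] k := digit_exists r (fun p => x (phi k * e`_p)).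
exists y => // -[[a b] t]; rewrite mem_reduction_patterns => /badP bad_abt.
case=> k [yk ykt]; case: bad_abt => [[p [q []]]|[P PF [p [q []]]]].
  rewrite mem_filter mem_triples /= => /andP[/eqP epq /and3P[_ lt_p lt_q]].
  by rewrite -yk -ykt !yP // phiM -mulgA epq.
rewrite mem_filter mem_triples /= => /andP[/eqP epq /and3P[_ lt_p lt_q]].
rewrite -yk !yP // => /val_inj xp /val_inj xq.
by apply: (xF P PF); exists (phi k * e`_p); rewrite -mulgA epq.
Qed.

Lemma consistent_digits y k t p q : subshift F' y ->
  t < size tau -> p < r -> q < r -> e`_p = phi tau`_t * e`_q ->
  digit n p (y k) = digit n q (y (k * tau`_t)).
Proof.
move=> yF lt_t lt_p lt_q epq; apply: contrapT => neq.
apply: (yF (y k, y (k * tau`_t), Ordinal lt_t)); last by exists k.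
rewrite mem_reduction_patterns; apply/badP; left; exists p, q; split=> //.
by rewrite mem_filter mem_triples /= lt_t lt_p lt_q epq eqxx.
Qed.

Lemma allowed_digits y k P p q : subshift F' y -> P \in F -> p < r -> q < r ->
  e`_p * sigma P.2 = e`_q -> digit n p (y k) = P.1.1 -> digit n q (y k) <> P.1.2.
Proof.
move=> yF PF lt_p lt_q epq dp dq.
(* The [D] clause of [bad] looks only at the first letter, so any generator can carry it; [tau_gt0]
   provides one. *)
apply: (yF (y k, y (k * tau`_0), Ordinal tau_gt0)); last by exists k.
rewrite mem_reduction_patterns; apply/badP; right; exists P => //; exists p, q.
by split=> //; rewrite mem_filter mem_triples /= ltn_ord lt_p lt_q epq eqxx.
Qed.

(** Induction along the growth of e', with the ambient e and its constraints fixed. The generator t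
    attaching g to h carries the digit at g of y(k) to the digit at h of y(kt) or y(kt^-1), where
    the induction hypothesis applies since it holds for every k. *)
Lemma connected_digits y e' : subshift F' y -> connected e' -> {subset e' <= e} ->
  forall g k, g \in e' ->
  digit n (index g e) (y k) = digit n (index (rep g) e) (y (k * sec g)).
Proof.
move=> yF; elim=> [_ g k g_reps|]; first by rewrite repK // sec_reps // mulg1.
move=> {}e' g h i _ IH he' lt_i gh sub g1 k.
have {}IH : forall g k, g \in e' ->
  digit n (index g e) (y k) = digit n (index (rep g) e) (y (k * sec g)).
  by apply: IH => z ze'; apply: sub; rewrite in_cons ze' orbT.
rewrite in_cons => /orP[/eqP->|]; last exact: IH.
have ge : g \in e by apply: sub; exact: mem_head.
have he : h \in e by apply: sub; rewrite in_cons he' orbT.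
have eK z : z \in e -> (index z e < r) * (e`_(index z e) = z).
  by move=> ze; rewrite index_mem nth_index.
case: gh => [gE|hE].
  rewrite (@consistent_digits y k i _ (index h e)) ?eK //.
  by rewrite IH // gE repM secM mulgA.
(* Here h = phi(t) g, so the constraint is read backwards, from k t^-1 to k. *)
have := @consistent_digits y (k * (tau`_i)^-1) i (index h e) (index g e) yF lt_i.
rewrite !eK // mulgVK => <- //.
by rewrite IH // hE repM secM mulgA mulgVK.
Qed.

Lemma step_subshift_decode y : subshift F' y ->
  exists2 x, step_subshift sigma F x &
    forall k g, g \in e -> x (phi k * g) = digit n (index g e) (y k) :> nat.
Proof.
move=> yF; have n_gt0 : 0 < n := leq_ltn_trans (leq0n _) (ltn_ord a0).
(* The value at g is the digit of y(sec g) at the representative of g; [connected_digits] shows that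
   every other window reading gives the same value. *)
pose x g := ord_mod n_gt0 (y (sec g) %/ n ^ index (rep g) e).
have xE k g : g \in e -> x (phi k * g) = digit n (index g e) (y k) :> nat.
  by move=> ge; rewrite (connected_digits yF e_conn) //= secM repM.
have eK z : z \in e -> (index z e < r) * (e`_(index z e) = z).
  by move=> ze; rewrite index_mem nth_index.
(* A pattern at g = phi(k) c with c a representative has both ends in the window of k, because c and
   its translate by the step lie in e. *)
exists x => // P PF [g]; rewrite (secP g) -mulgA => -[].
set k := sec g; set c := rep g => xc xcs.
have ce : c \in e.
  by elim: e_conn => [|e' ? ? ? _ IH _ _ _]; rewrite ?rep_reps // in_cons IH orbT.
have cse : c * sigma P.2 \in e by apply: e_sigma; rewrite ?rep_reps ?ltn_ord.
apply: (@allowed_digits y k P (index c e) (index (c * sigma P.2) e)) => //;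
  by rewrite ?eK // -xE // ?xc ?xcs.
Qed.

End Transfer.

(** * The two reductions to the problems of K *)

Section StepReducibility.

Variables (m : nat) (sigma : nat -> G).

(** The identity is listed separately because it need not be the chosen representative of its
    coset. *)
Lemma connected_exists : exists e, [/\ connected e, 1 \in e, {subset reps <= e} &
  forall c s, c \in reps -> s < m -> c * sigma s \in e].
Proof.
have [e e_conn sub] := connected_sup
  (1 :: reps ++ [seq c * sigma s | c <- reps, s <- iota 0 m]).
exists e; split=> // [|c c_reps|c s c_reps lt_s]; apply: sub.
- exact: mem_head.
- by rewrite in_cons mem_cat c_reps orbT.
rewrite in_cons mem_cat (_ : _ * _ \in allpairs _ _ _) ?orbT //.
by apply: allpairs_f => //; rewrite mem_iota.
Qed.

Lemma step_SDP_reducible : pos_reducible (@step_SDP G m sigma) (SDP tau).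
Proof.
have [e [e_conn e1 _ e_sigma]] := connected_exists.
set C := [seq c <- triples (size tau) (size e) |
  e`_c.1.2 == phi tau`_c.1.1 * e`_c.2].
set D := [seq d <- triples m (size e) | e`_d.1.2 * sigma d.1.1 == e`_d.2].
exists (reduction (size e) tau_gt0 C D [:: index 1 e]).
  exact: computable_reduction.
have lt_1 : index 1 e < size e by rewrite index_mem.
move=> [n [F a0]]; split=> [[x xF x1]|[Fi /mem_reduction[a [[p]]]]].
  have [y yF yE] := step_subshift_encode e a0 xF.
  exists [:: existT _ (n ^ size e)%N (reduction_patterns (size e) tau_gt0 C D F a0, y 1)].
    apply/mem_reduction; exists (y 1); split=> //; exists (index 1 e).
      exact: mem_head.
    by rewrite yE // nth_index // phi1 mulg1 x1.
  by move=> w; rewrite /= mem_seq1 => /eqP->; exists y.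
rewrite mem_seq1 => /eqP-> dE -> /(_ _ (mem_head _ _))[y yF y1].
have [x xF xE] := step_subshift_decode e_conn e_sigma yF.
exists x => //; apply: val_inj; rewrite /= -dE -y1 -xE //.
by rewrite phi1 mulg1.
Qed.

(** If x takes the value a_0 infinitely often, it does so on one coset with representative c, and
    there one letter of y recurs infinitely often, with digit a_0 at c. Conversely, each occurrence
    of that letter at k gives an occurrence of a_0 at phi(k) c, and these points are distinct. *)
Lemma step_RDP_reducible : pos_reducible (@step_RDP G m sigma) (RDP tau).
Proof.
have [e [e_conn _ e_reps e_sigma]] := connected_exists.
set C := [seq c <- triples (size tau) (size e) |
  e`_c.1.2 == phi tau`_c.1.1 * e`_c.2].
set D := [seq d <- triples m (size e) | e`_d.1.2 * sigma d.1.1 == e`_d.2].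
exists (reduction (size e) tau_gt0 C D [seq index c e | c <- reps]).
  exact: computable_reduction.
move=> [n [F a0]]; split=> [[x xF x_inf]|[Fi /mem_reduction[a [[p]]]]].
  have [y yF yE] := step_subshift_encode e a0 xF.
  have [|c c_reps {}x_inf] := infinite_fiber (f := rep) (s := reps) _ x_inf.
    by move=> g _; exact: rep_reps.
  have [|a _ a_inf] :=
    infinite_fiber (f := y \o sec) (s := enum 'I_(n ^ size e)%N) _ x_inf.
    by move=> g _; rewrite mem_enum.
  have ce := e_reps _ c_reps.
  exists [:: existT _ (n ^ size e)%N (reduction_patterns (size e) tau_gt0 C D F a0, a)].
    apply/mem_reduction; exists a; split=> //; exists (index c e).
      exact: map_f.
    (* Any point of the infinite fiber shows that the digit of a at c is a_0. *)
    have [g [[/= <- gc] <-]] := infinite_setN0 a_inf.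
    by rewrite yE ?index_mem // nth_index // -gc -secP.
  move=> w; rewrite /= mem_seq1 => /eqP->; exists y => //.
  apply: contra_not a_inf => fin.
  apply: sub_finite_set (finite_image (fun k => phi k * c) fin) => g [[_ gc] yg].
  by exists (sec g) => //; rewrite -gc -secP.
move=> /mapP[c c_reps ->] dE -> /(_ _ (mem_head _ _))[y yF y_inf].
have [x xF xE] := step_subshift_decode e_conn e_sigma yF.
exists x => //; apply: contra_not y_inf => fin.
apply: sub_finite_set (finite_image sec fin) => k /= yk.
exists (phi k * c); last by rewrite secM sec_reps // mulg1.
by apply: val_inj; rewrite /= -dE -yk xE // e_reps.
Qed.

End StepReducibility.

(** * Restriction to, and extension from, the left cosets of the image of K *)

Section Restriction.

Variables (m : nat) (sigma : nat -> K).

Lemma step_subshift_restrict n (F : seq (pattern n m)) x g :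
  step_subshift (phi \o sigma) F x -> step_subshift sigma F (fun k => x (g * phi k)).
Proof.
move=> xF P PF [k [xk xks]]; apply: (xF P PF); exists (g * phi k).
by rewrite xk -mulgA -phiM xks.
Qed.

(* Right equivariant ([extendM]), hence independent copies of x on the left
   cosets of phi(K); the factor [sec 1] makes it restrict to x on phi(K). *)
Definition extend (A : Type) (x : K -> A) (g : G) : A := x (sec 1 * (sec g^-1)^-1).

Lemma extendM A (x : K -> A) g k :
  extend x (g * phi k) = x (sec 1 * (sec g^-1)^-1 * k).
Proof.
have phiV l : phi l^-1 = (phi l)^-1.
  by apply: (mulgI (phi l)); rewrite -phiM !mulgV phi1.
by rewrite /extend invgM -phiV secM invgM invgK mulgA.
Qed.

Lemma extendK A (x : K -> A) k : extend x (phi k) = x k.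
Proof. by rewrite -[phi k]mul1g extendM invg1 mulgV mul1g. Qed.

Lemma step_subshift_extend n (F : seq (pattern n m)) x :
  step_subshift sigma F x -> step_subshift (phi \o sigma) F (extend x).
Proof.
move=> xF P PF [g [xg xgs]]; apply: (xF P PF).
by exists (sec 1 * (sec g^-1)^-1); split; rewrite // -extendM.
Qed.

Lemma step_SDP_restrict : @step_SDP G m (phi \o sigma) = step_SDP sigma.
Proof.
apply/seteqP; split=> -[n [F a0]] [x xF x1].
  exists (fun k => x (1 * phi k)); first exact: step_subshift_restrict.
  by rewrite phi1 mul1g.
by exists (extend x); [exact: step_subshift_extend | rewrite -phi1 extendK].
Qed.

(** Left cosets are classified by [rep g^-1]. Some coset c^-1 phi(K) contains infinitely many
    occurrences, and translating it to [K] keeps them; conversely [extend x] restricts to x on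
    phi(K), where phi is injective. *)
Lemma step_RDP_restrict : @step_RDP G m (phi \o sigma) = step_RDP sigma.
Proof.
apply/seteqP; split=> -[n [F a0]] [x xF x_inf].
  have [|c _ {}x_inf] := infinite_fiber (f := fun g => rep g^-1) (s := reps) _ x_inf.
    by move=> g _; exact: rep_reps.
  exists (fun k => x (c^-1 * phi k)); first exact: step_subshift_restrict.
  apply: contra_not x_inf => fin.
  apply: sub_finite_set (finite_image (fun k => c^-1 * phi k) fin) => g [xg gc].
  have gE : c^-1 * phi (sec g^-1)^-1 = g.
    apply: (mulIg (phi (sec g^-1))); rewrite -mulgA -phiM mulVg phi1 mulg1.
    by apply: (mulgI g^-1); rewrite mulKg {1}[g^-1]secP gc mulgK.
  by exists (sec g^-1)^-1; rewrite /= gE.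
exists (extend x); first exact: step_subshift_extend.
apply: contra_not x_inf => fin.
apply: sub_finite_set (finite_image (fun g => sec g * (sec 1)^-1) fin) => k /= xk.
by exists (phi k); rewrite /= ?extendK // -[phi k]mulg1 secM mulgK.
Qed.

End Restriction.
End Encoding.

Lemma SDP_step (G : groupType) (S : seq G) : SDP S = step_SDP (nth 1%g S).
Proof.
apply/seteqP; split=> -[n [F a0]] [x xF x1]; exists x => //.
  by move=> [[a b] i] PF; exact: (xF (a, b, i) PF).
by move=> [[a b] i] PF; exact: (xF (a, b, i) PF).
Qed.

Lemma RDP_step (G : groupType) (S : seq G) : RDP S = step_RDP (nth 1%g S).
Proof.
apply/seteqP; split=> -[n [F a0]] [x xF x1]; exists x => //.
  by move=> [[a b] i] PF; exact: (xF (a, b, i) PF).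
by move=> [[a b] i] PF; exact: (xF (a, b, i) PF).
Qed.

(** * Coset representatives and the conclusion *)

Section Transversal.

Variables (G : groupType) (P : {pred G}) (H : subGroupType P).

Local Open Scope group_scope.

Lemma transversal_exists : finite_index P ->
  exists (sec : G -> H) (rep : G -> G) (reps : seq G),
    [/\ forall g, g = (val (sec g) : G) * rep g,
        forall (k : H) g, rep (val k * g) = rep g,
        forall g, rep g \in reps &
        {in reps, forall c, rep c = c}].
Proof.
move=> fin_cosets.
(* Finite index is stated with left cosets, while [rep] must be constant on right cosets; inversion
   exchanges them, so g is labelled by the left coset of g^-1. *)
pose coset (g : G) := [set g^-1 * h | h in [set` P]].
(* The choice depends only on the coset, so equal cosets get equal representatives; the default 1
   never intervenes since g itself qualifies. *)
pose rep g := xget 1 [set g' | coset g' = coset g].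
have coset_rep g : coset (rep g) = coset g.
  by apply: (@xgetPex _ 1 [set g' | coset g' = coset g]); exists g.
have P1 : 1 \in P by rewrite -(val1 H); exact: valP.
have secP g : g * (rep g)^-1 \in P.
  have : coset (rep g) (rep g)^-1 by exists 1; rewrite ?mulg1.
  by rewrite coset_rep => -[h Ph <-]; rewrite mulVKg.
have valVg (k : H) : val k^-1 = (val k)^-1.
  by apply: (mulgI (val k)); rewrite -valM !mulgV val1.
have cosetM (k : H) g : coset (val k * g) `<=` coset g.
  move=> _ [h /= Ph <-]; exists (val (k^-1 * Sub h Ph)); first exact: valP.
  by rewrite valM valVg SubK mulgA invgM.
have repM (k : H) g : rep (val k * g) = rep g.
  rewrite /rep (_ : coset (val k * g) = coset g) //; apply/seteqP; split => //.
  by rewrite -{1}[g](mulKg (val k)) -valVg; exact: cosetM.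
have /finite_seqP[reps repsE] : finite_set (range rep).
  apply: sub_finite_set (finite_image (fun X => xget 1 [set g | coset g = X]) fin_cosets).
  by move=> _ [g _ <-]; exists (coset g) => //; exists g^-1.
exists (fun g => Sub (g * (rep g)^-1) (secP g)), rep, reps; split=> //.
- by move=> g; rewrite SubK mulgVK.
- by move=> g; have : range rep (rep g) by []; rewrite repsE.
move=> c c_reps; have [g _ <-] : range rep c by rewrite repsE.
by rewrite /rep coset_rep.
Qed.

End Transversal.

Lemma generates_nil (G : groupType) : generates (Nil G) -> [set: G] `<=` [set 1%g].
Proof.
move=> <-; apply: smallest_sub => //; split=> [|a b]; rewrite !inE //.
by move=> -> ->; rewrite mulgV.
Qed.

Theorem lemma14 (G : groupType) (P : {pred G}) (H : subGroupType P)
    (S : seq G) (T : seq H) :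
  infinite_set [set: G] ->
  finite_index P ->
  uniq S -> generates S ->
  uniq T -> generates T ->
  pos_equiv (SDP S) (SDP T) /\ pos_equiv (RDP S) (RDP T).
Proof.
move=> G_inf /(transversal_exists H)[sec [rep [reps [secP repM rep_reps repK]]]].
move=> _ S_gen _ T_gen.
have S_gt0 : 0 < size S.
  case: S S_gen => // /generates_nil G1; case: G_inf.
  exact: sub_finite_set G1 (finite_set1 _).
(* Without generators [H] would be trivial and [G] would be contained in the finite list of
   representatives. *)
have T_gt0 : 0 < size T.
  case: T T_gen => // /generates_nil H1; case: G_inf.
  apply: (@sub_finite_set _ _ [set` reps]); last exact: finite_seq.
  by move=> g _ /=; rewrite [g]secP (H1 (sec g)) // val1 mul1g rep_reps.
have val_morph : {morph (val : H -> G) : k l / (k * l)%g} by exact: valM.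
have val_inj' : injective (val : H -> G) by exact: val_inj.
(* Data for the case K = G: the embedding and the section are the identity, and 1 represents the
   only coset. *)
have id_morph : {morph (id : G -> G) : k l / (k * l)%g} by [].
have id_sec (g : G) : g = (g * 1)%g by rewrite mulg1.
have one_reps (g : G) : 1%g \in [:: 1%g : G] by rewrite mem_head.
have one_repK : {in [:: 1%g : G], forall c, 1%g = c}.
  by move=> c; rewrite mem_seq1 => /eqP.
split; split.
- rewrite SDP_step.
  exact: (step_SDP_reducible val_morph val_inj' T_gen T_gt0 secP repM rep_reps repK).
- rewrite (SDP_step T) -(step_SDP_restrict val_morph val_inj' secP repM).
  exact: (step_SDP_reducible id_morph (@inj_id _) S_gen S_gt0 id_sec
    (fun _ _ => erefl) one_reps one_repK).
- rewrite RDP_step.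
  exact: (step_RDP_reducible val_morph val_inj' T_gen T_gt0 secP repM rep_reps repK).
rewrite (RDP_step T) -(step_RDP_restrict val_morph val_inj' secP repM rep_reps).
exact: (step_RDP_reducible id_morph (@inj_id _) S_gen S_gt0 id_sec
    (fun _ _ => erefl) one_reps one_repK).
Qed.
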